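(* For every integer $k\ge3$, the permutation gate $U_k$ on $2^k-1$ qubits satisfies $U_k\in\mathcal{C}_3$ but $U_k^{-1}\notin\mathcal{C}_k$. Thus $U_k$ is not semi-Clifford.
   Context: Gates on $n$ qubits are unitary operators on $(\mathbb{C}^2)^{\otimes n}$, with computational basis $\{|v\rangle : v\in\mathbb{F}_2^n\}$. The Pauli group $\mathcal{P}_n$ consists of all $cP_1\otimes\cdots\otimes P_n$ with $c\in\{\pm1,\pm i\}$ and $P_j\in\{I_2,X,Y,Z\}$. The Clifford hierarchy: $\mathcal{C}_1=\mathcal{P}_n$, and for $m\ge2$, $\mathcal{C}_m$ is the set of unitaries $U$ with $UPU^\dagger\in\mathcal{C}_{m-1}$ for all $P\in\mathcal{P}_n$. $\mathcal{C}_2$ is the Clifford group. A gate is semi-Clifford if it equals $\phi_1d\phi_2$ for some Clifford gates $\phi_1,\phi_2$ and some gate $d$ that is diagonal in the computational basis. Definition of $U_k$. Let $n=2^k-1$ and label the standard basis vectors of $\mathbb{F}_2^n$ as $e_S$, for nonempty subsets $S\subseteq[k]$, where $S$ corresponds to the index $\sum_{i\in S}2^{i-1}\in\{1,\dots,n\}$. Define a bilinear multiplication on $\mathbb{F}_2^n$ by $e_Se_T=e_{S\cup T}$ if $S\cap T=\varnothing$ and $e_Se_T=0$ otherwise (it is commutative and associative). $U_k$ is the permutation gate on $n$ qubits defined by $$U_k\Big|\sum_{S\in A}e_S\Big\rangle=\Big|\sum_{B\subseteq A,\ B\neq\varnothing}\ \prod_{S\in B}e_S\Big\rangle$$ for every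 set $A$ of nonempty subsets of $[k]$. *)

(* Defs.v *)
From HB Require Import structures.
From mathcomp Require Import all_boot all_order all_algebra.
From mathcomp Require Import spectral.
Set Implicit Arguments.
Unset Strict Implicit.
Unset Printing Implicit Defensive.
Import GRing.Theory Num.Theory.
Local Open Scope ring_scope.
Local Open Scope sesquilinear_scope.

Notation bits n := 'rV['F_2]_n.

(* The computational basis is indexed by F_2^n itself: rows and columns of an
   n-qubit operator are numbered through [enum_rank : bits n -> 'I_#|bits n|]. *)
Notation qop C n := 'M[C]_#|{: bits n}|.

Section Gates.
Variables (C : numClosedFieldType) (n : nat).

Definition ket (v : bits n) : 'cV[C]_#|{: bits n}| := delta_mx (enum_rank v) 0.

Definition pauliX : 'M[C]_2 := \matrix_(i, j) (i != j)%:R.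
Definition pauliZ : 'M[C]_2 := \matrix_(i, j) ((-1) ^+ i *+ (i == j)).
Definition pauliY : 'M[C]_2 :=
  \matrix_(i, j) (if i == j then 0 else if i == 0 then - 'i else 'i).

(* P_1 (x) ... (x) P_n; an entry of a bit string, in 'F_2, is used as an index
   in 'I_2. *)
Definition tensor (P : 'I_n -> 'M[C]_2) : qop C n :=
  \matrix_(i, j) \prod_(q < n) 
    P q ((enum_val i : bits n) 0 q) ((enum_val j : bits n) 0 q).

Definition pauli (U : qop C n) : Prop :=
  exists c : C, exists P : 'I_n -> 'M[C]_2,
    [/\ c \in [:: 1; -1; 'i; - 'i],
        forall q, P q \in [:: 1%:M; pauliX; pauliY; pauliZ]
      & U = c *: tensor P].

(* The hierarchy starts at level 1; level 0 is a dummy, set to be empty. *)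
Fixpoint clifford_hierarchy (m : nat) (U : qop C n) : Prop :=
  if m isn't m1.+1 then False else
  if m1 is 0 then pauli U else
  U \is unitarymx /\
  forall P, pauli P -> clifford_hierarchy m1 (U *m P *m U ^t*).

Definition semi_clifford (U : qop C n) : Prop :=
  exists phi1 d phi2 : qop C n,
    [/\ clifford_hierarchy 2 phi1, clifford_hierarchy 2 phi2,
        d \is unitarymx, is_diag_mx d & U = phi1 *m d *m phi2].

(* The operator |v> |-> |f v>. *)
Definition basis_map (f : bits n -> bits n) : qop C n :=
  \matrix_(i, j) (enum_val i == f (enum_val j))%:R.

Lemma basis_map_ket f v : basis_map f *m ket v = ket (f v).
Proof.
apply/matrixP=> i j; rewrite !mxE (bigD1 (enum_rank v)) //= big1 => [|l nl].
  rewrite !mxE addr0 ord1 !eqxx mulr1 enum_rankK andbT; congr (_%:R).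
  by rewrite -[i in RHS]enum_valK (inj_eq enum_rank_inj).
by rewrite !mxE (negPf nl) mulr0.
Qed.

End Gates.

Section SubsetAlgebra.
Variable k : nat.
Implicit Types (S T : {set 'I_k}) (x y z : bits (2 ^ k - 1)).

(* [k] is {0, ..., k-1} here, so that i contributes 2 ^ i. *)
Definition subset_index S : nat := (\sum_(i in S) 2 ^ i)%N.

(* Indices 1, ..., 2 ^ k - 1 are the positions shifted by one; as a result
   evec set0 = 0. *)
Definition evec S : bits (2 ^ k - 1) :=
  \row_(j < 2 ^ k - 1) (j.+1 == subset_index S)%:R.

Definition ecoef x S : 'F_2 := \sum_(j < 2 ^ k - 1 | j.+1 == subset_index S) x 0 j.

Definition emul x y : bits (2 ^ k - 1) :=
  \sum_(S | S != set0) \sum_(T | T != set0)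
     (ecoef x S * ecoef y T) *:
       (if [disjoint S & T] then evec (S :|: T) else 0).

(* Product over a nonempty B; emul has no unit, and the value at set0 is a
   dummy. The order of the factors is irrelevant by emulC and emulA. *)
Definition eprod (B : {set {set 'I_k}}) : bits (2 ^ k - 1) :=
  if enum B is S1 :: s then foldl emul (evec S1) [seq evec T | T <- s] else 0.

(* The set A with x = \sum_(S in A) evec S. *)
Definition esupp x : {set {set 'I_k}} := [set S | S != set0 & ecoef x S != 0].

Definition Uk_fun x : bits (2 ^ k - 1) :=
  \sum_(B : {set {set 'I_k}} | (B \subset esupp x) && (B != set0)) eprod B.

Definition Uk (C : numClosedFieldType) : qop C (2 ^ k - 1) :=
  basis_map C Uk_fun.

Let bin_val m (b : nat -> bool) : nat := (\sum_(i < m) b i * 2 ^ i)%N.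

Let bin_valS m b :
  bin_val m.+1 b = (b 0 + (bin_val m (fun i => b i.+1)).*2)%N.
Proof.
rewrite /bin_val big_ord_recl /= muln1 -muln2 big_distrl /=; congr addn.
by apply: eq_bigr => i _; rewrite /bump /= expnSr mulnA.
Qed.

Let bin_val_inj m b c :
  bin_val m b = bin_val m c -> forall i, (i < m)%N -> b i = c i.
Proof.
elim: m b c => // m IH b c; rewrite !bin_valS => E.
have E0 : b 0 = c 0.
  by have := congr1 odd E; rewrite !oddD !odd_double !addbF !oddb.
move: E; rewrite E0 => /addnI/double_inj/IH {}IH [|i] //; exact: IH.
Qed.

Let bin_val_lt m b : (bin_val m b < 2 ^ m)%N.
Proof.
elim: m b => [|m IH] b; first by rewrite /bin_val big_ord0.
rewrite bin_valS expnS mul2n.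
have := IH (fun i => b i.+1); rewrite -leq_double doubleS.
by case: (b 0) => // /ltnW.
Qed.

Let subset_indexE S :
  subset_index S = bin_val k (fun i => [exists j in S, val j == i]).
Proof.
rewrite /subset_index big_mkcond; apply: eq_bigr => i _.
have -> : [exists j in S, val j == i] = (i \in S).
  apply/exists_inP/idP => [[j jS /eqP/val_inj <-] //|iS].
  by exists i.
by case: ifP; rewrite ?mul1n ?mul0n.
Qed.

Lemma subset_index_inj : injective subset_index.
Proof.
move=> S T; rewrite !subset_indexE => /bin_val_inj E.
apply/setP=> i; have := E i (ltn_ord i).
have H (R : {set 'I_k}) : [exists j in R, val j == i] = (i \in R).
  apply/exists_inP/idP => [[j jS /eqP/val_inj <-] //|iS].
  by exists i.
by rewrite !H.
Qed.

Lemma subset_index_bound S :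
  S != set0 -> (0 < subset_index S <= 2 ^ k - 1)%N.
Proof.
case/set0Pn=> i iS; apply/andP; split.
  by rewrite /subset_index (bigD1 i) //= ltn_addr // expn_gt0.
by rewrite -ltnS subn1 prednK ?expn_gt0 // subset_indexE bin_val_lt.
Qed.

Lemma ecoefD a x y S : ecoef (a *: x + y) S = a * ecoef x S + ecoef y S.
Proof.
rewrite /ecoef big_distrr -big_split.
by apply: eq_bigr => j _; rewrite !mxE.
Qed.

Lemma ecoef_sum I r (P : pred I) F S :
  ecoef (\sum_(i <- r | P i) F i) S = \sum_(i <- r | P i) ecoef (F i) S.
Proof.
by rewrite /ecoef exchange_big; apply: eq_bigr => j _; rewrite summxE.
Qed.

Lemma ecoef_evec S T : S != set0 -> ecoef (evec T) S = (S == T)%:R.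
Proof.
move=> /subset_index_bound/andP[S0 Sk].
have jP : ((subset_index S).-1 < 2 ^ k - 1)%N by rewrite prednK.
rewrite /ecoef (big_pred1 (Ordinal jP)) => [|j].
  by rewrite !mxE /= prednK // (inj_eq subset_index_inj).
by rewrite /= -val_eqE /= -{1}(prednK S0) eqSS.
Qed.

Lemma emul_linearl y : linear (emul^~ y).
Proof.
move=> a x x'; rewrite /emul scaler_sumr -big_split; apply: eq_bigr => S _ /=.
rewrite scaler_sumr -big_split; apply: eq_bigr => T _ /=.
by rewrite ecoefD mulrDl scalerDl scalerA mulrA.
Qed.

Lemma emulC x y : emul x y = emul y x.
Proof.
rewrite /emul exchange_big /=; apply: eq_bigr => S _; apply: eq_bigr => T _.
by rewrite mulrC disjoint_sym setUC.
Qed.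

Lemma emul_linearr x : linear (emul x).
Proof. by move=> a y y'; rewrite emulC emul_linearl !(emulC x). Qed.

Let linl y := GRing.isLinear.Build 'F_2 (bits (2 ^ k - 1)) (bits (2 ^ k - 1))
  *:%R (emul^~ y) (emul_linearl y).
Let emull y : {linear bits (2 ^ k - 1) -> bits (2 ^ k - 1)} :=
  HB.pack (emul^~ y) (linl y).

Let emul_suml I r (P : pred I) F y :
  emul (\sum_(i <- r | P i) F i) y = \sum_(i <- r | P i) emul (F i) y.
Proof. exact: (linear_sum (emull y)). Qed.

Let emulZl a x y : emul (a *: x) y = a *: emul x y.
Proof. exact: (linearZ_LR (emull y)). Qed.

Let emul0l y : emul 0 y = 0.
Proof. exact: (linear0 (emull y)). Qed.

Lemma emul_evecl S y : S != set0 ->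
  emul (evec S) y = \sum_(T | T != set0)
    ecoef y T *: (if [disjoint S & T] then evec (S :|: T) else 0).
Proof.
move=> S0; rewrite /emul (bigD1 S) //= [X in _ + X]big1 => [|R /andP[R0 RS]].
  by rewrite addr0; apply: eq_bigr => T _; rewrite ecoef_evec // eqxx mul1r.
by apply: big1 => T _; rewrite ecoef_evec // (negPf RS) mul0r scale0r.
Qed.

Lemma emul_evec S T : S != set0 -> T != set0 ->
  emul (evec S) (evec T) = if [disjoint S & T] then evec (S :|: T) else 0.
Proof.
move=> S0 T0; rewrite emul_evecl // (bigD1 T) //= [X in _ + X]big1.
  by rewrite ecoef_evec // eqxx scale1r addr0.
by move=> R /andP[R0 RT]; rewrite ecoef_evec // (negPf RT) scale0r.
Qed.

Let setU_n0 S T : S != set0 -> S :|: T != set0.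
Proof. by rewrite setU_eq0 negb_and => ->. Qed.

Let emul3 x y z : emul (emul x y) z =
  \sum_(S | S != set0) \sum_(T | T != set0) \sum_(V | V != set0)
    (ecoef x S * ecoef y T * ecoef z V) *:
      (if [&& [disjoint S & T], [disjoint S & V] & [disjoint T & V]]
       then evec (S :|: T :|: V) else 0).
Proof.
rewrite [X in emul X z]/emul emul_suml; apply: eq_bigr => S S0.
rewrite emul_suml; apply: eq_bigr => T T0.
rewrite emulZl /=; case: ifP => _; last first.
  by rewrite emul0l scaler0 big1 // => V _; rewrite /= scaler0.
rewrite emul_evecl ?setU_n0 // scaler_sumr; apply: eq_bigr => V _.
by rewrite scalerA -![[disjoint _ & V]]setI_eq0 setIUl setU_eq0.
Qed.

Lemma emulA x y z : emul x (emul y z) = emul (emul x y) z.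
Proof.
rewrite emulC !emul3 [RHS]exchange_big; apply: eq_bigr => T _.
rewrite [RHS]exchange_big; apply: eq_bigr => V _; apply: eq_bigr => S _.
congr (_ *: _); first by rewrite mulrC mulrA.
rewrite [T :|: V :|: S]setUC setUA ![[disjoint _ & S]]disjoint_sym.
by rewrite andbC andbA.
Qed.

Lemma esupp_sum (A : {set {set 'I_k}}) :
  set0 \notin A -> esupp (\sum_(S in A) evec S) = A.
Proof.
move=> A0; apply/setP=> S; rewrite inE; case: eqP => [->|/eqP S0].
  by rewrite (negPf A0).
rewrite ecoef_sum.
under eq_bigr do rewrite ecoef_evec //.
case: (boolP (S \in A)) => SA.
  rewrite (bigD1 S) //= eqxx big1 ?addr0 ?oner_eq0 // => T /andP[_ TS].
  by rewrite eq_sym (negPf TS).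
by rewrite big1 ?eqxx // => T TA; case: eqP SA TA => // -> /negPf ->.
Qed.

Lemma Uk_ket (C : numClosedFieldType) (A : {set {set 'I_k}}) :
  set0 \notin A ->
  Uk C *m ket C (\sum_(S in A) evec S) =
  ket C (\sum_(B : {set {set 'I_k}} | (B \subset A) && (B != set0)) eprod B).
Proof. by move=> A0; rewrite basis_map_ket /Uk_fun esupp_sum. Qed.

End SubsetAlgebra.

(* Main.v *)
(* With g(x) = 1 + U_k(x) in F_2[x_1, ..., x_k]/(x_i^2), one has
   g(x) = \prod_(S in supp x) (1 + e_S), and e_S^2 = 0 makes g a homomorphism
   from (F_2^n, +) to the multiplicative group of elements 1 + y. Hence U_k
   conjugates X^a to the permutation y |-> y + s + y s with s = U_k(a), which is
   affine. The inverse h of U_k, a truncated logarithm, satisfies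
   h(x + y) = h(x) + h(y) + x y, so that U_k conjugates Z^b to a quadratic phase;
   the product of the two is Clifford.

   In the other direction U_k^-1 conjugates Z^b to the phase (-1)^(b . U_k(x)).
   Conjugating a Pauli X by a phase (-1)^p differentiates p, so a phase in C_m has
   vanishing (m + 1)-fold derivatives; the k-fold derivative of the top
   coefficient of U_k along the e_{i} is 1, hence this phase is not in C_(k-1).

   Finally, C_m for m >= 2 is stable under multiplication by Cliffords and under
   entrywise complex conjugation, which inverts diagonal gates; so a semi-Clifford
   gate in C_3 has its inverse in C_3, which is contained in C_k. *)
Require Import Defs.
From mathcomp Require Import all_boot all_order all_algebra.
From mathcomp Require Import spectral complex.
From mathcomp Require Import reals ring.
Set Implicit Arguments.
Unset Strict Implicit.
Unset Printing Implicit Defensive.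
Import GRing.Theory Num.Theory.
Local Open Scope ring_scope.
Local Open Scope sesquilinear_scope.

(** * The subset algebra and U_k *)

Lemma F2P (a : 'F_2) : a = 0 \/ a = 1.
Proof. by case: a => [[|[|?]] ?] //; [left|right]; apply/val_inj. Qed.

(* Entrywise case analysis on the atoms; products [emul x y] count as atoms, so
   they must be expanded beforehand. *)
Ltac boolean_group :=
  let i := fresh "i" in
  let entryD := fresh "entryD" in
  let entry0 := fresh "entry0" in
  apply/rowP => i;
  have entryD : forall u v : bits _, (u + v) 0 i = u 0 i + v 0 i
    by [move=> ? ?; rewrite mxE];
  have entry0 : (0 : bits _) 0 i = 0 by [rewrite mxE];
  rewrite !(entryD, entry0) {entryD entry0};
  repeat match goal with
  | |- context [fun_of_matrix ?x ?r i] => move: (fun_of_matrix x r i)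
  end;
  do ?[let a := fresh in move=> a; case: (F2P a) => -> {a}];
  exact/eqP.

Section SubsetAlgebraTheory.
Variable k : nat.
Implicit Types (S T : {set 'I_k}) (x y z : bits (2 ^ k - 1)).

Lemma bits_addxx n (x : bits n) : x + x = 0.
Proof. by apply/rowP=> i; rewrite !mxE -mulr2n -mulr_natr pchar_Zp // mulr0. Qed.

Lemma emulDl x y z : emul (x + y) z = emul x z + emul y z.
Proof. by have := emul_linearl z 1 x y; rewrite !scale1r. Qed.

Lemma emulDr x y z : emul x (y + z) = emul x y + emul x z.
Proof. by rewrite emulC emulDl !(emulC x). Qed.

Lemma emul0l x : emul 0 x = 0.
Proof. by have := emulDl 0 0 x; rewrite addr0 => ->; rewrite bits_addxx. Qed.

Lemma emul0r x : emul x 0 = 0.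
Proof. by rewrite emulC emul0l. Qed.

Lemma subset_index_surj (j : 'I_(2 ^ k - 1)) : exists S, subset_index S = j.+1.
Proof.
have lt2k S : (subset_index S < 2 ^ k)%N.
  have [->|/subset_index_bound/andP[_]] := eqVneq S set0.
    by rewrite /subset_index big_set0 expn_gt0.
  by rewrite -ltnS subn1 prednK ?expn_gt0.
have inj : injective (fun S => Ordinal (lt2k S)).
  by move=> S T /(congr1 val)/subset_index_inj.
have jP : (j.+1 < 2 ^ k)%N.
  by have := ltn_ord j; rewrite ltn_subRL add1n.
have [|g _ gK] := inj_card_bij inj.
  by rewrite card_ord -[X in (_ <= X)%N]cardsT -powersetT card_powerset cardsT card_ord.
by exists (g (Ordinal jP)); have /(congr1 val) := gK (Ordinal jP).
Qed.

Lemma evec_expand x : x = \sum_(S in esupp x) evec S.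
Proof.
apply/rowP=> j; have [S Sj] := subset_index_surj j.
have S0 : S != set0.
  by apply/eqP=> S0; move: Sj; rewrite S0 /subset_index big_set0.
have xS : ecoef x S = x 0 j.
  by rewrite /ecoef (big_pred1 j) // => i /=; rewrite Sj eqSS.
have E T : evec T 0 j = (T == S)%:R.
  by rewrite mxE -Sj (inj_eq (@subset_index_inj k)) eq_sym.
rewrite summxE; under eq_bigr do rewrite E.
have [Sx|Sx] := boolP (S \in esupp x).
  rewrite (bigD1 S) //= eqxx big1 ?addr0 => [|T /andP[_ /negPf->] //].
  by move: Sx; rewrite inE S0 xS /=; case: (x 0 j) => [[|[|?]] ?] // _; apply/val_inj.
rewrite big1 => [|T]; last by case: eqP => // -> /(negP Sx).
by move: Sx; rewrite inE S0 xS negbK => /eqP.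
Qed.

Lemma bits_ind (P : bits (2 ^ k - 1) -> Prop) :
  P 0 -> (forall S x, S != set0 -> P x -> P (x + evec S)) -> forall x, P x.
Proof.
move=> P0 PS x; rewrite (evec_expand x).
have: forall S, S \in enum (esupp x) -> S != set0.
  by move=> S; rewrite mem_enum inE => /andP[].
rewrite -big_enum /=; elim: (enum _) => [|S s IH] sn0; first by rewrite big_nil.
rewrite big_cons addrC; apply: PS; first by apply: sn0; rewrite mem_head.
by apply: IH => T Ts; apply: sn0; rewrite inE Ts orbT.
Qed.

Lemma emul_evecK S : S != set0 -> emul (evec S) (evec S) = 0.
Proof.
by move=> S0; rewrite emul_evec // -setI_eq0 setIid (negPf S0).
Qed.

(** In characteristic 2 the cross terms of a square cancel, and each e_S squares to 0. *)
Lemma emulxx x : emul x x = 0.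
Proof.
elim/bits_ind: x => [|S x S0 IH]; first exact: emul0l.
by rewrite !(emulDl, emulDr) IH emul_evecK // addr0 add0r (emulC x) bits_addxx.
Qed.

Lemma emulxxy x y : emul x (emul x y) = 0.
Proof. by rewrite emulA emulxx emul0l. Qed.

(** [eprod] folds along an enumeration; rewriting it as a commutative big operation, with [None] as
    adjoined unit, lets any factor come first. *)
Lemma eprodU1 (B : {set {set 'I_k}}) S : S \notin B ->
  eprod (S |: B) = if B == set0 then evec S else emul (evec S) (eprod B).
Proof.
have eprodE (D : {set {set 'I_k}}) : D != set0 ->
    Some (eprod D) = \big[oAC (@emulA k) (@emulC k)/None]_(T in D) Some (evec T).
  rewrite -big_enum /eprod -card_gt0 cardE; case: (enum D) => // T s _.
  elim/last_ind: s => [|s V IH] /=; first by rewrite big_seq1.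
  by rewrite -rcons_cons map_rcons foldl_rcons big_rcons /= -IH oACE.
move=> SB; apply: Some_inj; rewrite eprodE; last first.
  by apply/set0Pn; exists S; rewrite setU11.
rewrite big_setU1 //=; case: eqP => [->|/eqP B0]; first by rewrite big_set0.
by rewrite -eprodE.
Qed.

Lemma esuppD_evec S x : S != set0 ->
  esupp (x + evec S) = if S \in esupp x then esupp x :\ S else S |: esupp x.
Proof.
move=> S0; have E T : T != set0 -> ecoef (x + evec S) T = ecoef x T + (T == S)%:R.
  by move=> T0; rewrite -[x]scale1r ecoefD scale1r mul1r ecoef_evec.
apply/setP=> T; have [->|T0] := eqVneq T set0.
  by case: ifP => _; rewrite !inE eqxx /= ?andbF // eq_sym (negPf S0).
rewrite !inE S0 T0 /= E //; have [->|TS] := eqVneq T S; last first.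
  by case: ifP; rewrite addr0 !inE T0 (negPf TS).
case: (ecoef x S) => [[|[|?]] ?] //=; by rewrite !inE ?eqxx.
Qed.

(** This is g(x + e_S) = g(x) (1 + e_S) for g = 1 + U_k. [H] handles S outside the support,
    splitting the subsets B according to whether they contain S. *)
Lemma Uk_funD_evec x S : S != set0 ->
  Uk_fun (x + evec S) = Uk_fun x + evec S + emul (Uk_fun x) (evec S).
Proof.
move=> S0; have H y : S \notin esupp y ->
    Uk_fun (y + evec S) = Uk_fun y + evec S + emul (Uk_fun y) (evec S).
  move=> Sy; rewrite {1}/Uk_fun esuppD_evec // (negPf Sy).
  rewrite (bigID (fun B : {set _} => S \in B)) /= addrC -addrA; congr (_ + _).
    apply: eq_bigl => B; rewrite andbAC; congr (_ && _).
    apply/andP/idP => [[/subsetP BSy SB]|BSy].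
      apply/subsetP=> T TB; have := BSy T TB.
      by case/setU1P => // TS; rewrite -TS TB in SB.
    by split; [rewrite (subset_trans BSy) ?subsetUr|apply: contra Sy => /(subsetP BSy)].
  (* The subsets containing S are [S |: D] with D inside the support of y; the empty D gives e_S,
     the others give the product term. *)
  rewrite (reindex_onto (fun D => S |: D) (fun B => B :\ S)) /= => [|B /andP[_]]; last first.
    exact: setD1K.
  rewrite (eq_bigl (fun D : {set {set 'I_k}} => D \subset esupp y)) => [|D]; last first.
    apply/idP/idP => [/andP[/andP[/andP[DSy _] _] /eqP DS]|Dy].
      rewrite -DS; apply/subsetP=> T; rewrite in_setD1 => /andP[TS TD].
      by have := subsetP DSy T TD; rewrite in_setU1 (negPf TS).
    have SD : S \notin D by apply: contra Sy => /(subsetP Dy).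
    rewrite setUS //= setU11 setU1K // eqxx !andbT.
    by apply/set0Pn; exists S; rewrite setU11.
  rewrite (bigD1 set0) ?sub0set //= eprodU1 ?inE // eqxx; congr (_ + _).
  rewrite emulC (big_morph _ (emulDr (evec S)) (emul0r _)).
  apply: eq_bigr => D /andP[Dy D0]; rewrite eprodU1 ?(negPf D0) //.
  by apply: contra Sy => /(subsetP Dy).
have [Sx|Sx] := boolP (S \in esupp x); last exact: H.
(* [H] at x + e_S expresses U_k(x) through U_k(x + e_S); this can be inverted because (1 + e_S)^2 =
   1. *)
have /H : S \notin esupp (x + evec S) by rewrite esuppD_evec // Sx !inE eqxx.
rewrite -addrA bits_addxx addr0 => ->.
by rewrite !emulDl -emulA emul_evecK // emul0r; boolean_group.
Qed.

Lemma Uk_fun0 : Uk_fun (0 : bits (2 ^ k - 1)) = 0.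
Proof.
rewrite /Uk_fun big_pred0 // => B; have -> : esupp (0 : bits (2 ^ k - 1)) = set0.
  apply/setP=> S; rewrite !inE /ecoef big1 ?eqxx ?andbF // => j _.
  by rewrite mxE.
by rewrite subset0 andbN.
Qed.

Lemma Uk_funD x y :
  Uk_fun (x + y) = Uk_fun x + Uk_fun y + emul (Uk_fun x) (Uk_fun y).
Proof.
elim/bits_ind: y => [|S y S0 IH]; first by rewrite Uk_fun0 emul0r !addr0.
by rewrite addrA !Uk_funD_evec // IH !(emulDl, emulDr) emulA; boolean_group.
Qed.

Lemma Uk_fun_evec S : S != set0 -> Uk_fun (evec S) = evec S.
Proof.
by move=> S0; rewrite -[evec S]add0r Uk_funD_evec // Uk_fun0 add0r emul0l addr0.
Qed.

(* The image is closed under [y + z + y z]; since [e_S^2 = 0], [y + e_S] is the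
   product in this sense of [y] and [e_S + e_S y]. *)
Lemma Uk_fun_bij : bijective (@Uk_fun k).
Proof.
have imM y z : (exists x, Uk_fun x = y) -> (exists x, Uk_fun x = z) ->
    exists x, Uk_fun x = y + z + emul y z.
  by move=> [x <-] [x' <-]; exists (x + x'); rewrite Uk_funD.
have im_evecM S y : S != set0 -> exists x, Uk_fun x = emul (evec S) y.
  move=> S0; elim/bits_ind: y => [|T y T0 IH].
    by exists 0; rewrite Uk_fun0 emul0r.
  (* Two multiples of e_S have product 0, so on them y + z + y z is just y + z. *)
  have {IH} IH : exists x, Uk_fun x =
      emul (evec S) y + emul (evec S) (evec T)
        + emul (emul (evec S) y) (emul (evec S) (evec T)).
    apply: imM => //; rewrite emul_evec //; case: ifP => _.
      by exists (evec (S :|: T)); rewrite Uk_fun_evec // setU_eq0 (negPf S0).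
    by exists 0; rewrite Uk_fun0.
  by move: IH; rewrite emulDr (emulC (evec S) y) -emulA emulxxy emul0r addr0.
have im y : exists x, Uk_fun x == y.
  suff [x <-] : exists x, Uk_fun x = y by exists x.
  elim/bits_ind: y => [|S y S0 IH]; first by exists 0; rewrite Uk_fun0.
  have im_eSy : exists x, Uk_fun x = evec S + emul (evec S) y.
    have := imM (evec S) (emul (evec S) y).
    rewrite emulxxy addr0; apply; last exact: im_evecM.
    by exists (evec S); rewrite Uk_fun_evec.
  have [x xE] := imM _ _ IH im_eSy.
  by exists x; rewrite xE !emulDr (emulC (evec S) y) emulxxy; boolean_group.
have [g gK] : exists g, cancel g (@Uk_fun k).
  by exists (fun y => xchoose (im y)) => y; apply/eqP/(xchooseP (im y)).
by exists g => //; exact: canF_sym.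
Qed.

(** The inverse h turns y + z + y z into a sum and fixes every multiple of e_S. For z = e_S + e_S y
    the combination is y + e_S, so h(y + e_S) = h(y) + e_S + e_S y; induction on y does the rest. *)
Lemma Uk_fun_inv_quadratic (h : bits (2 ^ k - 1) -> bits (2 ^ k - 1)) :
  cancel (@Uk_fun k) h -> cancel h (@Uk_fun k) ->
  forall x y, h (x + y) = h x + h y + emul x y.
Proof.
move=> fK hK.
have h0 : h 0 = 0 by rewrite -[in LHS]Uk_fun0 fK.
have h_evec S : S != set0 -> h (evec S) = evec S.
  by move=> S0; rewrite -{1}Uk_fun_evec // fK.
have hM x y : h (x + y + emul x y) = h x + h y.
  by rewrite -[RHS]fK Uk_funD !hK.
have h_evecM S y : S != set0 -> h (emul (evec S) y) = emul (evec S) y.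
  move=> S0; elim/bits_ind: y => [|T y T0 IH]; first by rewrite emul0r h0.
  have := hM (emul (evec S) y) (emul (evec S) (evec T)).
  rewrite (emulC (evec S) y) -(emulA y) emulxxy emul0r addr0.
  rewrite emulDr (emulC (evec S) y) => ->.
  rewrite -(emulC (evec S)) IH; congr (_ + _).
  rewrite emul_evec //; case: ifP => _; last exact: h0.
  by rewrite h_evec // setU_eq0 (negPf S0).
have hD_evec S y : S != set0 -> h (y + evec S) = h y + evec S + emul y (evec S).
  move=> S0; have := hM (evec S) (emul (evec S) y).
  rewrite emulxxy addr0 h_evecM // h_evec // => hSy.
  have := hM y (evec S + emul (evec S) y).
  rewrite hSy emulDr (emulC (evec S) y) emulxxy => E.
  rewrite -addrA -E; congr h; boolean_group.
move=> x y; elim/bits_ind: y => [|S y S0 IH]; first by rewrite h0 emul0r !addr0.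
rewrite addrA !hD_evec // IH !(emulDl, emulDr); boolean_group.
Qed.

End SubsetAlgebraTheory.

(** * Monomial operators and Pauli gates *)

Section MonomialOperators.
Variables (C : numClosedFieldType) (n : nat).
Implicit Types (f g : bits n -> bits n) (w u : bits n -> C) (U V P Q : qop C n).

(** The operator |v> |-> w(v) |f v>. Paulis, U_k and all conjugates computed below have this form,
    so matrix products become compositions of functions. *)
Definition monomial_op f w : qop C n :=
  \matrix_(i, j) (w (enum_val j) *+ (enum_val i == f (enum_val j))).

Lemma eq_monomial_op f g w u :
  f =1 g -> w =1 u -> monomial_op f w = monomial_op g u.
Proof. by move=> fg wu; apply/matrixP=> i j; rewrite !mxE fg wu. Qed.

Lemma monomial_op_eqP f g w u : (forall v, w v != 0) ->
  monomial_op f w = monomial_op g u -> f =1 g /\ w =1 u.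
Proof.
move=> w0 E; suff H v : f v = g v /\ w v = u v by split=> v; case: (H v).
have := congr1 (fun M : qop C n => M (enum_rank (f v)) (enum_rank v)) E.
rewrite !mxE !enum_rankK eqxx mulr1n; case: eqP => //= _ w0v.
by have := w0 v; rewrite w0v eqxx.
Qed.

Lemma mul_monomial_op f g w u :
  monomial_op f w *m monomial_op g u =
  monomial_op (f \o g) (fun v => w (g v) * u v).
Proof.
apply/matrixP=> i j; rewrite !mxE (bigD1 (enum_rank (g (enum_val j)))) //= big1.
  by rewrite !mxE enum_rankK eqxx addr0 mulrnAl.
move=> l nl; rewrite !mxE; have /negPf-> : enum_val l != g (enum_val j).
  by apply: contra nl => /eqP <-; rewrite enum_valK.
exact: mulr0.
Qed.

Lemma adj_monomial_op f g w : cancel f g -> cancel g f ->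
  (monomial_op f w)^t* = monomial_op g (fun v => (w (g v))^*).
Proof.
move=> fK gK; apply/matrixP=> i j; rewrite !mxE rmorphMn.
have -> : (enum_val j == f (enum_val i)) = (enum_val i == g (enum_val j)).
  by apply/eqP/eqP => ->; rewrite ?fK ?gK.
by case: eqP => // ->.
Qed.

Lemma monomial_op_unitary f w : bijective f -> (forall v, w v * (w v)^* = 1) ->
  monomial_op f w \is unitarymx.
Proof.
case=> g fK gK w1; apply/unitarymxP; rewrite (adj_monomial_op _ fK gK).
rewrite mul_monomial_op; apply/matrixP=> i j; rewrite !mxE /= w1 gK.
by rewrite (inj_eq enum_val_inj).
Qed.

Lemma conj_monomial_op f f' g w u : cancel f f' -> cancel f' f ->
  monomial_op f w *m monomial_op g u *m (monomial_op f w)^t* =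
  monomial_op (f \o g \o f')
    (fun v => w (g (f' v)) * u (f' v) * (w (f' v))^*).
Proof.
by move=> fK f'K; rewrite (adj_monomial_op _ fK f'K) !mul_monomial_op.
Qed.

(** * Signs and linear forms over F_2 *)

Definition sgF (x : 'F_2) : C := (-1) ^+ x.

Lemma sgF0 : sgF 0 = 1. Proof. by []. Qed.

Lemma sgFD x y : sgF (x + y) = sgF x * sgF y.
Proof.
by rewrite /sgF -exprD -signr_odd -[RHS]signr_odd /= modn2 oddb.
Qed.

Lemma sgF_conj x : (sgF x)^* = sgF x.
Proof. by rewrite /sgF rmorphXn rmorphN1. Qed.

Lemma sgFK x : sgF x * sgF x = 1.
Proof. by rewrite -sgFD; case: (F2P x) => ->. Qed.

Lemma sgF_neq0 x : sgF x != 0.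
Proof. by rewrite signr_eq0. Qed.

Lemma sgF_inj : injective sgF.
Proof.
move=> x y; case: (F2P x) => ->; case: (F2P y) => -> // /eqP;
by rewrite /sgF expr1 ?[_ == -1]eq_sym eqNr oner_eq0.
Qed.

Definition dotF (b v : bits n) : 'F_2 := \sum_q b 0 q * v 0 q.

Lemma dotFD b x y : dotF b (x + y) = dotF b x + dotF b y.
Proof. by rewrite /dotF -big_split; apply: eq_bigr => q _; rewrite mxE mulrDr. Qed.

Lemma additive_dotF (l : bits n -> 'F_2) :
  (forall x y, l (x + y) = l x + l y) -> exists b, l =1 dotF b.
Proof.
move=> lD; have l0 : l 0 = 0.
  by have := lD 0 0; rewrite addr0 => /esym/eqP; rewrite -subr_eq0 addrK => /eqP.
exists (\row_q l (delta_mx 0 q)) => v; rewrite {1}[v]row_sum_delta.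
rewrite (big_morph l lD l0); apply: eq_bigr => q _; rewrite mxE.
by case: (F2P (v 0 q)) => ->; rewrite ?scale0r ?scale1r ?mulr0 ?mulr1.
Qed.

(** * Pauli gates in the form c X^a Z^b *)

Definition pauli_phases : seq C := [:: 1; -1; 'i; - 'i].

Lemma pauli_phasesE (c : C) : (c \in pauli_phases) = (c ^+ 4 == 1).
Proof.
have -> : (c ^+ 4 == 1) = ((c - 1) * (c + 1) * ((c - 'i) * (c + 'i)) == 0).
  by rewrite -!subr_sqr sqrCi opprK expr1n -subr_sqr expr1n -exprM subr_eq0.
by rewrite !mulf_eq0 !subr_eq0 !addr_eq0 !inE -!orbA.
Qed.

Lemma phase_norm (c : C) : c ^+ 4 = 1 -> c * c^* = 1.
Proof.
move=> c4; rewrite -normCK; have /eqP := congr1 Num.norm c4.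
by rewrite normrX normr1 pexpr_eq1 // => /eqP->; rewrite expr1n.
Qed.

(* X^a Z^b on one qubit. *)
Definition pauli2 (a b : 'F_2) : 'M[C]_2 :=
  \matrix_(i, j) (sgF (b * j) *+ ((i : 'F_2) == (j : 'F_2) + a)).

Lemma pauli2P (P : 'M[C]_2) :
  P \in [:: 1%:M; pauliX C; pauliY C; pauliZ C] ->
  exists t : 'F_2 * 'F_2 * C, t.2 ^+ 4 = 1 /\ P = t.2 *: pauli2 t.1.1 t.1.2.
Proof.
have i4 : 'i ^+ 4 = 1 :> C by rewrite (exprM _ 2 2) sqrCi sqrrN expr1n.
rewrite !inE => /or4P[] /eqP->.
- exists (0, 0, 1); split; first exact: expr1n.
  apply/matrixP=> i j; rewrite scale1r !mxE.
  by case: (F2P i) => ->; case: (F2P j) => ->.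
- exists (1, 0, 1); split; first exact: expr1n.
  apply/matrixP=> i j; rewrite scale1r !mxE.
  by case: (F2P i) => ->; case: (F2P j) => ->.
(* Y = i X Z. *)
- exists (1, 1, 'i); split=> //.
  apply/matrixP=> i j; rewrite !mxE.
  by case: (F2P i) => ->; case: (F2P j) => ->; rewrite /sgF /= ?mulr0 ?mulrN1 ?mulr1.
- exists (0, 1, 1); split; first exact: expr1n.
  apply/matrixP=> i j; rewrite scale1r !mxE.
  by case: (F2P i) => ->; case: (F2P j) => ->.
Qed.

Lemma pauli2_pauli (a b : 'F_2) : exists t : 'M[C]_2 * C,
  [/\ t.1 \in [:: 1%:M; pauliX C; pauliY C; pauliZ C], t.2 ^+ 4 = 1
    & pauli2 a b = t.2 *: t.1].
Proof.
have i4 : (- 'i) ^+ 4 = 1 :> C.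
  by rewrite (exprM _ 2 2) sqrrN sqrCi sqrrN expr1n.
case: (F2P a) => ->; case: (F2P b) => ->.
- exists (1%:M, 1); rewrite !inE eqxx expr1n; split=> //.
  apply/matrixP=> i j; rewrite scale1r !mxE.
  by case: (F2P i) => ->; case: (F2P j) => ->.
- exists (pauliZ C, 1); rewrite !inE eqxx ?orbT expr1n; split=> //.
  apply/matrixP=> i j; rewrite scale1r !mxE.
  by case: (F2P i) => ->; case: (F2P j) => ->.
- exists (pauliX C, 1); rewrite !inE eqxx ?orbT expr1n; split=> //.
  apply/matrixP=> i j; rewrite scale1r !mxE.
  by case: (F2P i) => ->; case: (F2P j) => ->.
- exists (pauliY C, - 'i); rewrite !inE eqxx ?orbT; split=> //.
  apply/matrixP=> i j; rewrite !mxE.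
  case: (F2P i) => ->; case: (F2P j) => ->;
  by rewrite /sgF /= ?mulr0 ?mulrNN ?mulNr -?expr2 ?sqrCi ?opprK.
Qed.

Definition pauli_op (c : C) (a b : bits n) : qop C n :=
  monomial_op (fun v => v + a) (fun v => c * sgF (dotF b v)).

Lemma tensor_pauli2 (c : 'I_n -> C) (a b : 'I_n -> 'F_2) :
  tensor (fun q => c q *: pauli2 (a q) (b q)) =
  pauli_op (\prod_q c q) (\row_q a q) (\row_q b q).
Proof.
apply/matrixP=> i j; rewrite !mxE -mulrnAr.
rewrite (eq_bigr (fun q => c q * sgF (b q * enum_val j 0 q) *
    (enum_val i 0 q == enum_val j 0 q + a q)%:R)) => [|q _]; last first.
  by rewrite !mxE -mulrA mulr_natr.
rewrite big_split /= big_split /= -mulrA -[in RHS]mulr_natr; congr (_ * (_ * _)).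
  rewrite -(big_morph sgF sgFD sgF0) /dotF; congr sgF.
  by apply: eq_bigr => q _; rewrite !mxE.
case: eqP => [E|E].
  by rewrite big1 // => q _; rewrite E !mxE eqxx.
apply/eqP; rewrite eq_sym; apply/eqP.
have [q Eq] : exists q, (enum_val i : bits n) 0 q != (enum_val j : bits n) 0 q + a q.
  apply/existsP; rewrite -negb_forall; apply/negP => /forallP H; apply: E.
  by apply/rowP=> q; rewrite !mxE; apply/eqP.
by rewrite (bigD1 q) //= (negPf Eq) mul0r.
Qed.

Lemma tensorZ (c : 'I_n -> C) (P : 'I_n -> 'M[C]_2) :
  tensor (fun q => c q *: P q) = (\prod_q c q) *: tensor P.
Proof.
by apply/matrixP=> i j; rewrite !mxE -big_split; apply: eq_bigr => q _; rewrite mxE.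
Qed.

Lemma eq_tensor (P Q : 'I_n -> 'M[C]_2) : P =1 Q -> tensor P = tensor Q.
Proof.
by move=> PQ; apply/matrixP=> i j; rewrite !mxE; apply: eq_bigr => q _; rewrite PQ.
Qed.

(** Fourth roots of unity are closed under products, so the phases of the n tensor factors can be
    collected in c. *)
Lemma pauli_opP (U : qop C n) :
  pauli U <-> exists c a b, c ^+ 4 = 1 /\ U = pauli_op c a b.
Proof.
split=> [[c [P [cP PP ->]]]|[c [a [b [c4 ->]]]]].
  have /fin_all_exists[t tP] := fun q => pauli2P (PP q).
  move: cP; rewrite pauli_phasesE => /eqP c4.
  exists (c * \prod_q (t q).2), (\row_q (t q).1.1), (\row_q (t q).1.2); split.
    rewrite exprMn c4 mul1r -prodrXl big1 // => q _; exact: (tP q).1.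
  rewrite (eq_tensor (fun q => (tP q).2)) tensor_pauli2.
  by apply/matrixP=> i j; rewrite !mxE mulrnAr mulrA.
have /fin_all_exists[t tP] := fun q => pauli2_pauli (a 0 q) (b 0 q).
exists (c * \prod_q (t q).2), (fun q => (t q).1); split.
- rewrite pauli_phasesE exprMn c4 mul1r -prodrXl big1 // => q _.
  by case: (tP q).
- by move=> q; case: (tP q).
rewrite -scalerA -tensorZ -(eq_tensor (P := fun q => 1 *: pauli2 (a 0 q) (b 0 q))).
  rewrite tensor_pauli2 big1 //.
  have row_id (x : bits n) : \row_q x 0 q = x by apply/rowP=> q; rewrite mxE.
  by rewrite !row_id; apply/matrixP=> i j; rewrite !mxE mul1r mulrnAr.
by move=> q; rewrite scale1r; case: (tP q).
Qed.

End MonomialOperators.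

(** * The Clifford hierarchy *)

Ltac boolean_ring :=
  rewrite ?dotFD;
  repeat match goal with
  | |- context [dotF ?b ?x] => move: (dotF b x)
  end;
  do ?[let a := fresh in move=> a; case: (F2P a) => -> {a}];
  exact/eqP.

Section CliffordHierarchy.
Variables (C : numClosedFieldType) (n : nat).
Implicit Types (U V P Q phi : qop C n).

Lemma adj_mul U V : (U *m V)^t* = V^t* *m U^t*.
Proof. by rewrite trmx_mul map_mxM. Qed.

Lemma unitary_adjK U : U \is unitarymx -> U^t* *m U = 1%:M.
Proof. by rewrite -trmxC_unitary => /unitarymxP; rewrite trmxCK. Qed.

Lemma phase_conj (c u : C) (x y : 'F_2) : c ^+ 4 = 1 ->
  c * sgF C x * u * (c * sgF C y)^* = u * sgF C (x + y).
Proof.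
move=> /phase_norm c1; rewrite rmorphM /= sgF_conj sgFD -[RHS]mul1r -c1; ring.
Qed.

(** [additive_dotF] turns l into some b, and the sign of e is absorbed into c, which stays a fourth
    root of unity. *)
Lemma pauli_monomial a w (c : C) (l : bits n -> 'F_2) (e : 'F_2) :
  c ^+ 4 = 1 -> (forall x y, l (x + y) = l x + l y) ->
  (forall v, w v = c * sgF C (l v + e)) ->
  pauli (monomial_op (fun v => v + a) w).
Proof.
move=> c4 /additive_dotF[b lb] wE; apply/pauli_opP.
exists (c * sgF C e), a, b; split.
  by rewrite exprMn c4 mul1r (exprM _ 2 2) [X in X ^+ 2]expr2 sgFK expr1n.
by apply: eq_monomial_op => // v; rewrite wE lb sgFD; ring.
Qed.

Lemma bits_addK (a : bits n) : cancel (fun v => v + a) (fun v => v + a).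
Proof. by move=> v; rewrite -addrA bits_addxx addr0. Qed.

Lemma pauli_unitary P : pauli P -> P \is unitarymx.
Proof.
move=> /pauli_opP[c [a [b [c4 ->]]]]; apply: monomial_op_unitary.
  by exists (fun v => v + a); exact: bits_addK.
move=> v; have := phase_conj 1 (dotF b v) (dotF b v) c4.
by rewrite mulr1 mul1r sgFD sgFK.
Qed.

Lemma pauli_conj P Q : pauli P -> pauli Q -> pauli (P *m Q *m P^t*).
Proof.
move=> /pauli_opP[c [a [b [c4 ->]]]] /pauli_opP[d [a' [b' [d4 ->]]]].
rewrite (conj_monomial_op _ _ _ (@bits_addK a) (@bits_addK a)).
have E : (fun v => v + a) \o (fun v => v + a') \o (fun v => v + a) =1
    fun v => v + a' by move=> v /=; boolean_group.
rewrite (eq_monomial_op E (frefl _)).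
(* The constant is the symplectic product of (a, b) and (a', b'): Paulis commute up to this sign. *)
apply: (@pauli_monomial a' _ d (dotF b') (dotF b a' + dotF b' a)) => //.
  exact: dotFD.
move=> v; rewrite phase_conj // -mulrA -sgFD; congr (_ * sgF C _).
boolean_ring.
Qed.

Lemma clifford_hierarchyP m U :
  clifford_hierarchy m.+2 U <-> U \is unitarymx /\
    forall P, pauli P -> clifford_hierarchy m.+1 (U *m P *m U^t*).
Proof. by []. Qed.

Lemma clifford_hierarchy_unitary m U : clifford_hierarchy m U -> U \is unitarymx.
Proof. by case: m => [|[|m]] // => [/pauli_unitary|[]]. Qed.

Lemma clifford_hierarchyS m U :
  clifford_hierarchy m U -> clifford_hierarchy m.+1 U.
Proof.
elim: m U => [|[|m] IH] U //.
  by move=> PU; split=> [|P]; [exact: pauli_unitary|exact: pauli_conj].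
by move=> [uU HU]; split=> // P /HU/IH.
Qed.

Lemma clifford_hierarchy_le m m' U : (m <= m')%N ->
  clifford_hierarchy m U -> clifford_hierarchy m' U.
Proof.
by move=> /subnKC<- HU; elim: (m' - m)%N => [|d IH]; rewrite ?addn0 ?addnS //;
  exact: clifford_hierarchyS.
Qed.

Lemma map_conjCK U : map_mx Num.conj (map_mx Num.conj U) = U.
Proof. by apply/matrixP=> i j; rewrite !mxE conjCK. Qed.

(** Entrywise conjugation respects products and adjoints and maps Paulis to Paulis, so conjugating P
    by the image of U gives the image of a conjugate of a Pauli by U. *)
Lemma clifford_hierarchy_map_conj m U :
  clifford_hierarchy m U -> clifford_hierarchy m (map_mx Num.conj U).
Proof.
have pauli_map P : pauli P -> pauli (map_mx Num.conj P).
  move=> /pauli_opP[c [a [b [c4 ->]]]]; apply/pauli_opP.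
  exists c^*, a, b; split; first by rewrite -rmorphXn c4 rmorph1.
  by apply/matrixP=> i j; rewrite !mxE rmorphMn rmorphM /= sgF_conj.
elim: m U => [|[|m] IH] U //; first exact: pauli_map.
move=> [uU HU]; split; first by rewrite conjC_unitary.
move=> P /pauli_map/HU/IH.
by rewrite !map_mxM map_conjCK map_trmx.
Qed.

Definition all_paulis : seq (qop C n) :=
  undup [seq pauli_op c ab.1 ab.2 | c <- pauli_phases C, ab <- enum {: bits n * bits n}].

Lemma all_paulisP P : pauli P <-> P \in all_paulis.
Proof.
rewrite mem_undup; split=> [/pauli_opP[c [a [b [c4 ->]]]]|/allpairsP[[c [a b]] /=]].
  apply/allpairsP; exists (c, (a, b)); split=> //=; last by rewrite mem_enum.
  by rewrite pauli_phasesE c4.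
case; rewrite pauli_phasesE => /eqP c4 _ ->.
by apply/pauli_opP; exists c, a, b.
Qed.

(* Conjugation by phi is an injective self-map of the finite set of Paulis,
   hence surjective. *)
Lemma clifford_adj phi : clifford_hierarchy 2 phi -> clifford_hierarchy 2 (phi^t*).
Proof.
move=> [uphi Hphi]; split; first by rewrite trmxC_unitary.
move=> P /all_paulisP; rewrite trmxCK.
have conjK : cancel (fun Q => phi *m Q *m phi^t*) (fun Q => phi^t* *m Q *m phi).
  move=> Q; rewrite -!mulmxA (unitary_adjK uphi) mulmx1.
  by rewrite mulmxA (unitary_adjK uphi) mul1mx.
pose s := [seq phi *m Q *m phi^t* | Q <- all_paulis].
have us : uniq s by rewrite map_inj_uniq ?undup_uniq //; exact: can_inj conjK.
have s_sub : {subset s <= all_paulis}.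
  by move=> Q /mapP[Q' /all_paulisP/Hphi HQ' ->]; apply/all_paulisP.
have [|_ <-] := uniq_min_size us s_sub; first by rewrite size_map.
by move=> /mapP[Q /all_paulisP PQ ->]; rewrite conjK.
Qed.

(** The gate phi V phi^-1 sends P to phi (V Q V^-1) phi^-1, where Q = phi^-1 P phi is Pauli by
    [clifford_adj]. *)
Lemma clifford_hierarchy_conj m phi V : clifford_hierarchy 2 phi ->
  clifford_hierarchy m V -> clifford_hierarchy m (phi *m V *m phi^t*).
Proof.
move=> Cphi; elim: m V => [|[|m] IH] V //; first by case: Cphi => _; apply.
move=> [uV HV]; have uphi := clifford_hierarchy_unitary Cphi.
split; first by rewrite !mul_unitarymx ?trmxC_unitary.
move=> P /(clifford_adj Cphi).2/HV/IH; rewrite !adj_mul !trmxCK.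
by rewrite !mulmxA.
Qed.

Lemma clifford_hierarchy_mulr m phi U : clifford_hierarchy 2 phi ->
  clifford_hierarchy m.+2 U -> clifford_hierarchy m.+2 (U *m phi).
Proof.
move=> [uphi Hphi] /clifford_hierarchyP[uU HU]; apply/clifford_hierarchyP.
split; first exact: mul_unitarymx.
by move=> P /Hphi/HU; rewrite adj_mul !mulmxA.
Qed.

(** Write phi U as (phi U phi^-1) phi. *)
Lemma clifford_hierarchy_mull m phi U : clifford_hierarchy 2 phi ->
  clifford_hierarchy m.+2 U -> clifford_hierarchy m.+2 (phi *m U).
Proof.
move=> Cphi HU; have := clifford_hierarchy_mulr Cphi (clifford_hierarchy_conj Cphi HU).
by rewrite -(mulmxA (phi *m U)) unitary_adjK ?mulmx1 //; case: Cphi.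
Qed.

(* The adjoint of a diagonal gate is its entrywise complex conjugate. *)
Lemma semi_clifford_adj m U : semi_clifford U ->
  clifford_hierarchy m.+2 U -> clifford_hierarchy m.+2 (U^t*).
Proof.
move=> [phi1 [d [phi2 [C1 C2 ud /is_diag_mxP dd UE]]]] HU.
have u1 := clifford_hierarchy_unitary C1; have u2 := clifford_hierarchy_unitary C2.
have dE : d = phi1^t* *m U *m phi2^t*.
  rewrite UE -!mulmxA (unitarymxP u2) mulmx1.
  by rewrite mulmxA unitary_adjK // mul1mx.
have Hd : clifford_hierarchy m.+2 d.
  rewrite dE; apply: clifford_hierarchy_mulr; first exact: clifford_adj.
  by apply: clifford_hierarchy_mull => //; exact: clifford_adj.
have d_adj : d^t* = map_mx Num.conj d.
  apply/matrixP=> i j; rewrite !mxE; have [->//|ij] := eqVneq i j.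
  by rewrite !dd // eq_sym.
rewrite UE !adj_mul; apply: clifford_hierarchy_mull; first exact: clifford_adj.
apply: clifford_hierarchy_mulr; first exact: clifford_adj.
by rewrite d_adj; exact: clifford_hierarchy_map_conj.
Qed.

(** * Derivatives of sign exponents *)

Definition derivF (b : bits n) (p : bits n -> 'F_2) : bits n -> 'F_2 :=
  fun v => p (v + b) + p v.

Definition derivsF (bs : seq (bits n)) (p : bits n -> 'F_2) : bits n -> 'F_2 :=
  foldl (fun q b => derivF b q) p bs.

Lemma eq_derivsF bs p q : p =1 q -> derivsF bs p =1 derivsF bs q.
Proof.
by elim: bs p q => //= b bs IH p q pq; apply: IH => x; rewrite /derivF !pq.
Qed.

Lemma derivsF_shift bs p a v :
  derivsF bs (fun x => p (x + a)) v = derivsF bs p (v + a).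
Proof.
elim: bs p => //= b bs IH p.
transitivity (derivsF bs (fun x => derivF b p (x + a)) v); last exact: IH.
by apply: eq_derivsF => x; rewrite /derivF addrAC.
Qed.

(* For M = |v> |-> (-1)^(p v) |v + a>, conjugating X^b by M yields an operator
   of the same shape, with p replaced by a translate of its b-derivative. *)
Lemma clifford_hierarchy_derivsF m p a bs :
  clifford_hierarchy m (monomial_op (fun v : bits n => v + a) (fun v => sgF C (p v))) ->
  size bs = m.+1 -> forall v, derivsF bs p v = 0.
Proof.
elim: m p a bs => [|[|m] IH] p a bs //.
  move=> /pauli_opP[c [a' [b' [c4 E]]]].
  have [|_ pE] := monomial_op_eqP _ E; first by move=> v; exact: sgF_neq0.
  (* At v = 0 the Pauli phase c equals the sign of p(0), so p is affine and its second derivatives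
     vanish. *)
  have {pE} [e pE] : exists e, forall v, p v = dotF b' v + e.
    exists (p 0) => v; apply: (@sgF_inj C); rewrite sgFD !pE mulrCA -!sgFD; congr (_ * sgF C _).
    by rewrite -dotFD addr0.
  case: bs => [|b [|b2 []]] //= _ v; rewrite /derivF !pE.
  by case: (F2P e) => ->; boolean_ring.
move=> [_ HU]; case: bs => // b bs [sz] v.
have /HU : pauli (monomial_op (fun v => v + b) (fun => 1 : C)).
  apply: (@pauli_monomial _ _ 1 (fun => 0) 0) => [|x y|x].
  - exact: expr1n.
  - by rewrite addr0.
  - by rewrite mul1r.
rewrite (conj_monomial_op _ _ _ (@bits_addK a) (@bits_addK a)).
have E : (fun v => v + a) \o (fun v => v + b) \o (fun v => v + a) =1
    fun v => v + b by move=> x /=; boolean_group.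
rewrite (eq_monomial_op (u := fun v => sgF C (derivF b p (v + a))) E); last first.
  by move=> x; rewrite mulr1 sgF_conj -sgFD.
move=> /(IH (fun v => derivF b p (v + a)))/(_ sz) H.
(* Evaluating at v + a undoes the translation by a. *)
by have := H (v + a); rewrite derivsF_shift -addrA bits_addxx addr0.
Qed.

End CliffordHierarchy.

(** * The gates U_k *)

Section UkHierarchy.
Variables (C : numClosedFieldType) (k : nat).
Implicit Types (x y : bits (2 ^ k - 1)).

Lemma UkE : Uk k C = monomial_op (@Uk_fun k) (fun => 1).
Proof. by []. Qed.

Lemma Uk_unitary : Uk k C \is unitarymx.
Proof.
by rewrite UkE; apply: monomial_op_unitary; [exact: Uk_fun_bij|move=> v; rewrite rmorph1 mulr1].
Qed.

Lemma Uk_third_level : clifford_hierarchy 3 (Uk k C).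
Proof.
have [h fK hK] := @Uk_fun_bij k; have hD := Uk_fun_inv_quadratic fK hK.
apply/clifford_hierarchyP; split; first exact: Uk_unitary.
move=> _ /pauli_opP[c [a [b [c4 ->]]]].
rewrite UkE (conj_monomial_op _ _ _ fK hK).
(* On basis states U_k X^a U_k^-1 acts as A, an affine map; it is an involution because s s = 0. *)
pose s := Uk_fun a; pose A y := y + s + emul y s.
have AK : cancel A A.
  move=> y; rewrite /A !emulDl emulxx -emulA emulxx emul0r; boolean_group.
have fhA : @Uk_fun k \o (fun v => v + a) \o h =1 A.
  by move=> y; rewrite /= Uk_funD hK.
rewrite (eq_monomial_op (u := fun v => c * sgF C (dotF b (h v))) fhA); last first.
  by move=> y; rewrite mul1r rmorph1 mulr1.
apply/clifford_hierarchyP; split.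
  apply: monomial_op_unitary; first by exists A.
  move=> v; have := phase_conj 1 (dotF b (h v)) (dotF b (h v)) c4.
  by rewrite mulr1 mul1r sgFD sgFK.
move=> _ /pauli_opP[d [a' [b' [d4 ->]]]].
rewrite (conj_monomial_op _ _ _ AK AK).
(* Conjugating a translation by an affine map applies the linear part, here y + y s, to the
   translation vector. *)
have AAA : A \o (fun v => v + a') \o A =1 fun v => v + (a' + emul a' s).
  move=> y /=; rewrite /A !emulDl emulxx -emulA emulxx emul0r; boolean_group.
rewrite (eq_monomial_op AAA (frefl _)).
(* Since h(A v + a') + h(A v) = h(a') + (A v) a', the sign exponent is b'.(A v) + b.(h(a') + (A v)
   a'); given here are its linear and constant parts. *)
apply: (@pauli_monomial _ _ _ _ d
  (fun v => dotF b' v + dotF b' (emul v s) + dotF b (emul v a')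
            + dotF b (emul (emul v s) a'))
  (dotF b' s + dotF b (h a') + dotF b (emul s a'))) => // [x y|v].
  by rewrite !emulDl; boolean_ring.
rewrite phase_conj // -mulrA -sgFD; congr (_ * sgF C _).
by rewrite hD /A !emulDl; boolean_ring.
Qed.

Lemma foldl_emul_singletons (S : {set 'I_k}) (t : seq 'I_k) :
  S != set0 -> uniq t -> {in t, forall i, i \notin S} ->
  foldl (@emul k) (evec S) [seq evec [set i] | i <- t] = evec (S :|: [set i in t]).
Proof.
elim: t S => [|i t IH] S S0 /=; first by rewrite set_nil setU0.
case/andP=> it ut tS; have iS := tS i (mem_head _ _).
have i0 : [set i] != set0 by apply/set0Pn; exists i; rewrite set11.
rewrite emul_evec // disjoint_sym disjoints1 iS.
rewrite IH ?setU_eq0 ?negb_and ?S0 //.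
  by rewrite -setUA -set_cons.
move=> j jt; rewrite !inE negb_or tS ?inE ?jt ?orbT //=.
by apply: contra it => /eqP <-.
Qed.

(** The term c + c U_k(v) stands for c g(v) with g = 1 + U_k. As g(v + b) + g(v) = g(v) U_k(b), a
    derivative along b multiplies c by U_k(b). *)
Lemma derivsF_Uk_fun (l : bits (2 ^ k - 1) -> 'F_2) (bs : seq (bits (2 ^ k - 1))) c x :
  (forall x y, l (x + y) = l x + l y) ->
  derivsF bs (fun v => l (c + emul c (Uk_fun v))) x =
  let c' := foldl (@emul k) c (map (@Uk_fun k) bs) in l (c' + emul c' (Uk_fun x)).
Proof.
move=> lD; elim: bs c => //= b bs IH c; rewrite -IH; apply: eq_derivsF => v.
rewrite /derivF -lD; congr l; rewrite Uk_funD !emulDr (emulC (Uk_fun v)) emulA.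
boolean_group.
Qed.

(* The k-fold derivative of 1 + U_k(x) = \prod_(S in supp x) (1 + e_S) along the
   singletons e_{i} is (1 + U_k(x)) \prod_i e_{i}, whose top coefficient is 1. *)
Lemma Uk_inv_level : (1 < k)%N -> ~ clifford_hierarchy k (invmx (Uk k C)).
Proof.
move=> k_gt1; rewrite invmx_unitary ?Uk_unitary //.
have [h fK hK] := @Uk_fun_bij k.
have lD x y : ecoef (x + y) setT = ecoef x setT + ecoef y setT.
  by rewrite -[x]scale1r ecoefD scale1r mul1r.
have [b lE] := additive_dotF lD.
have k2 : (k - 2).+2 = k by rewrite -addn2 subnK.
rewrite -[X in clifford_hierarchy X _]k2.
(* The test Pauli is Z^b, where b reads off the coefficient of e_[k]. *)
move=> /clifford_hierarchyP[_ /(_ (pauli_op 1 0 b))].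
have Pb : pauli (pauli_op (1 : C) 0 b).
  by apply/pauli_opP; exists 1, 0, b; split=> //; exact: expr1n.
move=> /(_ Pb); rewrite trmxCK UkE (adj_monomial_op _ fK hK) !mul_monomial_op.
(* The identity permutation is kept as a translation by 0, the shape that
   [clifford_hierarchy_derivsF] expects. *)
have hf : h \o (fun v => v + 0) \o @Uk_fun k =1 fun v => v + 0.
  by move=> v /=; rewrite !addr0 fK.
rewrite (eq_monomial_op (u := fun v => sgF C (dotF b (Uk_fun v))) hf); last first.
  by move=> v; rewrite rmorph1 mulr1 !mul1r.
move=> /(@clifford_hierarchy_derivsF _ _ _ _ _ [seq evec [set i] | i <- enum 'I_k]).
rewrite size_map size_enum_ord k2 => /(_ erefl 0).
have k0 : size (enum 'I_k) != 0 by rewrite size_enum_ord -lt0n (ltnW k_gt1).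
have := enum_uniq 'I_k; have : [set i in enum 'I_k] = setT.
  by apply/setP=> i; rewrite !inE mem_enum.
case: (enum 'I_k) k0 => // i t _ tT /= /andP[it ut].
have s0 (j : 'I_k) : [set j] != set0 by apply/set0Pn; exists j; rewrite set11.
(* The algebra has no unit to serve as the initial c, so the first derivative is computed separately
   and starts the product with e_{i}. *)
rewrite (@eq_derivsF _ _ _ (fun v =>
    dotF b (evec [set i] + emul (evec [set i]) (Uk_fun v)))) => [|v]; last first.
  by rewrite /derivF -dotFD Uk_funD_evec // emulC; congr dotF; boolean_group.
rewrite derivsF_Uk_fun; last exact: dotFD.
rewrite -map_comp (eq_map (g := fun i => evec [set i])) => [|j]; last first.
  by rewrite /= Uk_fun_evec.
rewrite foldl_emul_singletons // => [|j jt]; last first.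
  by rewrite inE; apply: contra it => /eqP <-.
(* At 0 only e_[k] remains, with coefficient 1, whereas the derivative should vanish. *)
rewrite -set_cons tT /= Uk_fun0 emul0r addr0 -lE ecoef_evec ?eqxx //.
by apply/set0Pn; exists i; rewrite inE.
Qed.

End UkHierarchy.

Theorem theorem5p4 (R : realType) (k : nat) (hk : (3 <= k)%N) :
  [/\ clifford_hierarchy 3 (Uk k R[i]),
      ~ clifford_hierarchy k (invmx (Uk k R[i]))
    & ~ semi_clifford (Uk k R[i])].
Proof.
have U3 := Uk_third_level R[i] k; have Uinv := Uk_inv_level (C := R[i]) (ltnW hk).
(* The adjoint of a unitary is its inverse, and C_3 lies in C_k as k >= 3. *)
split=> // /semi_clifford_adj/(_ U3).
by rewrite -invmx_unitary ?Uk_unitary // => /(clifford_hierarchy_le hk).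
Qed.
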